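(* Let $d\in\mathbb{N}$. A hereditary digraph property $P=\bigcup_nP_n$ is $1$-sided error strongly-testable in the $FB(d)$-model if and only if for every $\epsilon>0$ there are $r=r(\epsilon)$, $n^*_\epsilon\in\mathbb{N}$ and an $r$-set of digraphs $\mathcal{H}$ such that for every $n>n^*_\epsilon$: (a) $P_n\subseteq P^*_{\mathcal{H}_n}$, and (b) $P^*_{\mathcal{H}_n}$ is $\epsilon/2$-close to $P_n$, where $P^*_{\mathcal{H}_n}$ is the set of $n$-vertex digraphs of the $FB(d)$-model that are $\mathcal{H}$-free as induced subgraphs.
   Context: The $FB(d)$-model consists of all digraphs (no multiple edges, anti-parallel edges allowed) in which every vertex has in-degree and out-degree at most $d$. A query to an $n$-vertex digraph specifies a vertex $v$ and returns $(\Gamma^+(v),\Gamma^-(v))$, its out- and in-neighbour sets. A digraph property is a set of digraphs closed under isomorphism, $P_n$ its $n$-vertex members; it is hereditary if for every $G$ in it and every vertex $v$, $G\setminus\{v\}$ is in it. $G$ is $\mathcal{H}$-free as induced subgraphs if no induced subgraph of $G$ is isomorphic to a member of $\mathcal{H}$; an $r$-set is a set of digraphs each with at most $r$ vertices. For $n$-vertex digraphs of the model, $G$ is $\epsilon$-far from $G'$ if more than $\epsilon dn$ edge deletions/insertions are needed to turn $G$ into $G'$, otherwise $\epsilon$-close; $G$ is $\epsilon$-close to a set if close to some member; two sets are $\epsilon$-close if every member of each is $\epsilon$-close to the other. A $1$-sided error $\epsilon$-test for $P$ accepts every $n$-vertex digraph in $P$ with probability $1$ and rejects every $n$-vertex digraph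 $\epsilon$-far from $P_n$ with probability at least $1/2$; $P$ is $1$-sided error strongly-testable if for every $\epsilon\in(0,1)$ it has such a test whose number of queries is bounded by a function of $\epsilon$ only. *)

(* Defs.v *)
From HB Require Import structures.
From mathcomp Require Import all_boot all_order all_algebra.
From mathcomp Require Import classical_sets reals.

Set Implicit Arguments.
Unset Strict Implicit.
Unset Printing Implicit Defensive.

Import Order.TTheory GRing.Theory Num.Theory.

(* Loopless digraphs on the vertex set {0, ..., n-1}; as the arcs form a set of
   ordered pairs, there are no multiple edges but there may be anti-parallel
   ones. *)
Record digraph (n : nat) := Digraph {
  arcs :> {set 'I_n * 'I_n};
  arcs_loopless : [forall v, (v, v) \notin arcs] }.

HB.instance Definition _ n := [isSub for @arcs n].
HB.instance Definition _ n := [Finite of digraph n by <:].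

Section Digraphs.
Variable n : nat.
Implicit Types (G : digraph n) (v : 'I_n) (U : {set 'I_n}).

Definition outnbr G v : {set 'I_n} := [set w | (v, w) \in arcs G].
Definition innbr G v : {set 'I_n} := [set w | (w, v) \in arcs G].

Definition FB (d : nat) G : bool :=
  [forall v, (#|outnbr G v| <= d) && (#|innbr G v| <= d)].

Definition induced_arcs G U : {set 'I_#|U| * 'I_#|U|} :=
  [set p | (enum_val p.1, enum_val p.2) \in arcs G].

Lemma induced_loopless G U : [forall v, (v, v) \notin induced_arcs G U].
Proof. by apply/forallP => v; rewrite inE; apply: (forallP (arcs_loopless G)). Qed.

(* The subgraph induced by U, its vertices being renamed 0, ..., #|U|-1. *)
Definition induced G U : digraph #|U| := Digraph (induced_loopless G U).

Definition del_vertex G v : digraph #|[set~ v]| := induced G [set~ v].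

(* The number of arc deletions and insertions that turn G1 into G2. *)
Definition edit_dist G1 G2 : nat :=
  #|(arcs G1 :\: arcs G2) :|: (arcs G2 :\: arcs G1)|%SET.

End Digraphs.

Definition isomorphic m n (G : digraph m) (F : digraph n) : Prop :=
  exists f : 'I_m -> 'I_n, bijective f /\
    forall u v, ((f u, f v) \in arcs F) = ((u, v) \in arcs G).

Definition digraph_class := forall n, set (digraph n).

Definition iso_closed (P : digraph_class) : Prop :=
  forall m n (G : digraph m) (F : digraph n), isomorphic G F -> P m G -> P n F.

Definition hereditary (P : digraph_class) : Prop :=
  forall n (G : digraph n) (v : 'I_n), P n G -> P _ (del_vertex G v).

Definition r_set (r : nat) (H : digraph_class) : Prop :=
  forall n (F : digraph n), H n F -> n <= r.

(* P_n in the FB(d)-model: the class P itself may contain digraphs of larger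
   degree, which are not inputs of the model. *)
Definition members (d : nat) (P : digraph_class) (n : nat) : set (digraph n) :=
  fun G => FB d G /\ P n G.
Arguments members : clear implicits.

Definition induced_free n (H : digraph_class) (G : digraph n) : Prop :=
  forall U k (F : digraph k), H k F -> ~ isomorphic (induced G U) F.

Definition free_members (d : nat) (H : digraph_class) (n : nat) :
    set (digraph n) :=
  fun G => FB d G /\ induced_free H G.
Arguments free_members : clear implicits.

(* Adaptive deterministic algorithms: [Query v k] queries v and continues with
   k (out-neighbours, in-neighbours). *)
Inductive qtree (n : nat) :=
  | Verdict of bool
  | Query of 'I_n & ({set 'I_n} * {set 'I_n} -> qtree n).

Fixpoint accepts n (t : qtree n) (G : digraph n) : bool :=
  match t with
  | Verdict b => b
  | Query v k => accepts (k (outnbr G v, innbr G v)) G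
  end.

Fixpoint queries n (t : qtree n) (G : digraph n) : nat :=
  match t with
  | Verdict _ => 0
  | Query v k => (queries (k (outnbr G v, innbr G v)) G).+1
  end.

Local Open Scope ring_scope.

(* A randomized algorithm on n-vertex inputs is a probability distribution on
   deterministic ones. A finite sample space loses no generality, as
   deterministic algorithms have finitely many behaviours on the finitely many
   inputs. *)
Record rand_alg (R : realType) (n : nat) := RandAlg {
  outcome : finType;
  weight : outcome -> R;
  weight_ge0 : forall w, 0 <= weight w;
  weight_sum1 : \sum_w weight w = 1;
  strategy : outcome -> qtree n }.

Arguments weight {R n} _ _.
Arguments strategy {R n} _ _.

Section Testing.
Variables (R : realType) (d : nat).
Implicit Types (P : digraph_class) (eps : R).

Definition prob_accept n (A : rand_alg R n) (G : digraph n) : R :=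
  \sum_(w | accepts (strategy A w) G) weight A w.

Definition prob_reject n (A : rand_alg R n) (G : digraph n) : R :=
  \sum_(w | ~~ accepts (strategy A w) G) weight A w.

Definition eps_close eps n (G1 G2 : digraph n) : Prop :=
  (edit_dist G1 G2)%:R <= eps * d%:R * n%:R.

Definition close_to eps n (G : digraph n) (S : set (digraph n)) : Prop :=
  exists2 G', S G' & eps_close eps G G'.

Definition far_from eps n (G : digraph n) (S : set (digraph n)) : Prop :=
  ~ close_to eps G S.

Definition close_sets eps n (S1 S2 : set (digraph n)) : Prop :=
  (forall G, S1 G -> close_to eps G S2) /\
  (forall G, S2 G -> close_to eps G S1).

Definition one_sided_test eps P n (A : rand_alg R n) : Prop :=
  (forall G, members d P n G -> prob_accept A G = 1) /\
  (forall G, FB d G -> far_from eps G (members d P n) ->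
     1 / 2 <= prob_reject A G).

Definition query_bound (q : nat) n (A : rand_alg R n) : Prop :=
  forall (w : outcome A) (G : digraph n),
    FB d G -> (queries (strategy A w) G <= q)%N.

Definition one_sided_strongly_testable P : Prop :=
  forall eps, 0 < eps < 1 ->
    exists q : nat, forall n, exists A : rand_alg R n,
      query_bound q A /\ one_sided_test eps P A.

End Testing.

(* Main.v *)
(* From the tester to the obstructions: take as forbidden the small digraphs
   that occur as induced subgraphs in no large member of P. If an H-free G were
   far from P_n, some run of the tester would reject it; the closed
   neighbourhood W of the queried vertices occurs in arbitrarily large members
   of P, and deleting superfluous vertices from such a member yields an n-vertex
   member on which the same run sees the same answers, contradicting
   one-sidedness.

   Conversely, the tester samples a constant number of vertices, explores their
   balls and rejects if it sees a forbidden induced subgraph. Isolating the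
   vertices whose ball has a rare isomorphism type costs few edits, so if G is
   far from P_n the result G' still contains a forbidden F. Every component of F
   in G' is a single vertex or lies in a ball of common type, so samples of the
   right types that are far apart carry a copy of F in G. *)
Require Import Defs.
From HB Require Import structures.
From mathcomp Require Import all_boot all_order all_algebra.
From mathcomp Require Import boolp classical_sets reals.
From mathcomp Require Import zify lra.

Set Implicit Arguments.
Unset Strict Implicit.
Unset Printing Implicit Defensive.

Import Order.TTheory GRing.Theory Num.Theory.

(** * Embeddings and induced subgraphs *)

Definition embedding m n (F : digraph m) (G : digraph n) (f : 'I_m -> 'I_n) :=
  injective f /\
  forall u v, ((f u, f v) \in arcs G) = ((u, v) \in arcs F).

Lemma arcs_irrefl n (G : digraph n) v : ((v, v) \in arcs G) = false.
Proof. exact/negbTE/(forallP (arcs_loopless G)). Qed.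

Lemma induced_embedding n (G : digraph n) U : embedding (induced G U) G enum_val.
Proof. by split=> [|u v]; [apply: enum_val_inj | rewrite inE]. Qed.

Lemma induced_factor m n (F : digraph m) (G : digraph n) f (U : {set 'I_n}) :
  embedding F G f -> (forall u, f u \in U) ->
  exists g, embedding F (induced G U) g /\ forall u, enum_val (g u) = f u.
Proof.
move=> [f_inj Ef] fU.
pose g u := enum_rank_in (fU u) (f u).
have gE u : enum_val (g u) = f u by rewrite enum_rankK_in.
exists g; split=> //; split=> [u v guv | u v]; last by rewrite inE /= !gE Ef.
by apply: f_inj; rewrite -!gE guv.
Qed.

Lemma embedding_isomorphic n (F G : digraph n) f :
  embedding F G f -> isomorphic F G.
Proof. by move=> [f_inj Ef]; exists f; split=> //; apply: injF_bij. Qed.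

(** The image of an embedding serves as the vertex set [U]. Embeddings are easier to compose than
    isomorphisms with renamed induced subgraphs. *)
Lemma induced_freeP n (H : digraph_class) (G : digraph n) :
  induced_free H G <-> forall k (F : digraph k) f, H k F -> ~ embedding F G f.
Proof.
split=> [freeG k F f HF Ff | freeG U k F HF [h [[h' hK h'K] Eh]]].
  have fU u : f u \in f @: [set: 'I_k] by apply: imset_f; rewrite inE.
  have [g [[g_inj Eg] gE]] := induced_factor Ff fU.
  have g_bij : bijective g.
    by apply: inj_card_bij => //; rewrite !card_ord card_imset ?cardsT ?card_ord //; case: Ff.
  case: g_bij => g' gK g'K.
  apply: (freeG _ _ _ HF); exists g'; split; first by exists g.
  by move=> u v; rewrite -Eg !g'K.
apply: (freeG k F (enum_val \o h') HF); split.
  by apply: inj_comp; [apply: enum_val_inj | apply: can_inj h'K].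
by move=> u v; rewrite -[u in RHS]h'K -[v in RHS]h'K Eh inE.
Qed.

(** Induction on the size of [G]: if [f] misses a vertex, it factors through the deletion of that
    vertex; otherwise it is an isomorphism. *)
Lemma hereditary_embedding (P : digraph_class) :
  iso_closed P -> hereditary P ->
  forall m n (F : digraph m) (G : digraph n) f, embedding F G f -> P n G -> P m F.
Proof.
move=> isoP herP m n; elim/ltn_ind: n => n IHn F G f Ff PG.
have [f_surj | /existsP[v fv]] := boolP [forall v, v \in codom f]; last first.
  have fU u : f u \in [set~ v].
    by rewrite !inE; apply: contraNneq fv => <-; apply: codom_f.
  have [g [Fg _]] := induced_factor Ff fU.
  apply: (IHn #|[set~ v]| _ F (del_vertex G v) g Fg); last exact: herP.
  by rewrite cardsC1 card_ord; case: (n) v {fv fU g Fg} => [[]|].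
have eq_mn : m = n.
  have := card_codom Ff.1; rewrite card_ord => <-.
  rewrite -[RHS]card_ord; apply: eq_card => v.
  by rewrite (forallP f_surj) inE.
case: n / eq_mn in G f Ff PG {IHn f_surj} *.
have [h [[h' hK h'K] Eh]] := embedding_isomorphic Ff.
apply: isoP PG; exists h'; split; first by exists h.
by move=> u v; rewrite -Eh !h'K.
Qed.

(** * Neighbourhoods *)

Section Neighbourhoods.
Variables (n d : nat).
Implicit Types (G : digraph n) (S : {set 'I_n}).

Definition nbrs G v := (outnbr G v :|: innbr G v)%SET.

Definition expand G S := (S :|: \bigcup_(v in S) nbrs G v)%SET.

Lemma mem_nbrs G u v :
  (v \in nbrs G u) = ((u, v) \in arcs G) || ((v, u) \in arcs G).
Proof. by rewrite !inE. Qed.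

Lemma nbrs_sym G u v : (v \in nbrs G u) = (u \in nbrs G v).
Proof. by rewrite !mem_nbrs orbC. Qed.

Lemma card_nbrs G v : FB d G -> #|nbrs G v| <= d.*2.
Proof.
move=> /forallP/(_ v)/andP[out_d in_d].
by rewrite (leq_trans (leq_card_setU _ _)) // -addnn leq_add.
Qed.

Lemma card_bigcup_nbrs G S : FB d G -> #|\bigcup_(v in S) nbrs G v| <= #|S| * d.*2.
Proof.
move=> FG; rewrite -sum_nat_const.
elim/big_rec2: _ => [|v m A _ Am]; first by rewrite cards0.
by rewrite (leq_trans (leq_card_setU _ _)) // leq_add // card_nbrs.
Qed.

Lemma card_expand G S : FB d G -> #|expand G S| <= #|S| * d.*2.+1.
Proof.
move=> FG; rewrite (leq_trans (leq_card_setU _ _)) // mulnS leq_add2l.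
exact: card_bigcup_nbrs.
Qed.

Lemma card_iter_expand G S l : FB d G -> #|iter l (expand G) S| <= #|S| * d.*2.+1 ^ l.
Proof.
move=> FG; elim: l => [|l IHl]; first by rewrite muln1.
by rewrite iterS (leq_trans (card_expand _ FG)) // expnSr mulnA leq_mul2r IHl orbT.
Qed.

Lemma expand_self G S : S \subset expand G S.
Proof. by rewrite /expand finset.subsetUl. Qed.

Lemma expand_nbr G S u v : u \in S -> v \in nbrs G u -> v \in expand G S.
Proof. by move=> uS uv; rewrite inE; apply/orP; right; apply/finset.bigcupP; exists u. Qed.

Lemma iter_expand_mono G S S' l :
  S \subset S' -> iter l (expand G) S \subset iter l (expand G) S'.
Proof.
move=> sub; elim: l => //= l IHl; apply: finset.setUSS => //.
apply/finset.bigcupsP => v vS; apply: finset.bigcup_sup (fintype.subsetP IHl _ vS).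
Qed.

(* The neighbours of [v] occupy ports [0, 1, ..]; all remaining ports, in
   particular the last one, lead back to [v]. *)
Definition port G v (i : 'I_d.*2.+1) := nth v (enum (nbrs G v)) i.

Definition node G v (x : seq 'I_d.*2.+1) := foldl (port G) v x.

Lemma portP G v i : port G v i = v \/ port G v i \in nbrs G v.
Proof.
rewrite /port; have [lt_i | le_i] := ltnP i (size (enum (nbrs G v))).
  by right; rewrite -mem_enum mem_nth.
by left; rewrite nth_default.
Qed.

Lemma port_max G v : FB d G -> port G v ord_max = v.
Proof. by move=> FG; rewrite /port nth_default // -cardE card_nbrs. Qed.

Lemma port_surj G v w : FB d G -> w \in nbrs G v -> exists i, port G v i = w.
Proof.
move=> FG vw.
have lt_i : index w (enum (nbrs G v)) < d.*2.+1.
  by rewrite ltnS (leq_trans (index_size _ _)) // -cardE card_nbrs.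
by exists (Ordinal lt_i); rewrite /port nth_index // mem_enum.
Qed.

Lemma node_cat G v x y : node G v (x ++ y) = node G (node G v x) y.
Proof. exact: foldl_cat. Qed.

Lemma node_stay G v m : FB d G -> node G v (nseq m ord_max) = v.
Proof. by move=> FG; elim: m => //= m IHm; rewrite port_max. Qed.

Lemma node_expand G S v x :
  v \in S -> node G v x \in iter (size x) (expand G) S.
Proof.
elim: x v S => //= i x IHx v S vS; rewrite -iterS iterSr; apply: IHx.
case: (portP G v i) => [-> | vi]; last exact: expand_nbr vS vi.
exact: (fintype.subsetP (expand_self G S)).
Qed.

Lemma node_expand_rev G S v x l :
  node G v x \in iter l (expand G) S -> v \in iter (size x + l) (expand G) S.
Proof.
elim: x v => //= i x IHx v /IHx.
case: (portP G v i) => [-> | ]; first exact/fintype.subsetP/expand_self.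
by rewrite nbrs_sym => vi iS; apply: expand_nbr vi.
Qed.

End Neighbourhoods.

(** * Query trees *)

Section Exploration.
Variable n : nat.
Implicit Types (G : digraph n) (S : {set 'I_n}).

Definition answered : Type := 'I_n * ({set 'I_n} * {set 'I_n}).

Definition transcript := seq answered.

Definition record_of G (s : seq 'I_n) : transcript :=
  [seq (v, (outnbr G v, innbr G v)) | v <- s].

(** Out-neighbour answers alone determine the arcs. The test [p.1 != p.2] makes every transcript,
    even an inconsistent one, yield a loopless digraph. *)
Definition revealed_arcs (t : transcript) : {set 'I_n * 'I_n} :=
  [set p | (p.1 != p.2) && has (fun a : answered => (a.1 == p.1) && (p.2 \in a.2.1)) t].

Lemma revealed_loopless t : [forall v, (v, v) \notin revealed_arcs t].
Proof. by apply/forallP => v; rewrite inE eqxx. Qed.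

Definition revealed t : digraph n := Digraph (revealed_loopless t).

Lemma revealedE G s u v :
  u \in s -> ((u, v) \in arcs (revealed (record_of G s))) = ((u, v) \in arcs G).
Proof.
move=> us; rewrite inE /= has_map.
apply/andP/idP => [[_ /hasP[w ws /andP[/= /eqP <-]]] | uv]; first by rewrite inE.
split; first by apply: contraTneq uv => <-; rewrite arcs_irrefl.
by apply/hasP; exists u => //=; rewrite eqxx inE.
Qed.

Fixpoint query_seq (s : seq 'I_n) (K : transcript -> qtree n) : qtree n :=
  if s is v :: s' then Query v (fun a => query_seq s' (fun t => K ((v, a) :: t)))
  else K [::].

Lemma accepts_query_seq s K G :
  accepts (query_seq s K) G = accepts (K (record_of G s)) G.
Proof. by elim: s K => //= v s IHs K; rewrite IHs. Qed.

Lemma queries_query_seq s K G :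
  queries (query_seq s K) G = size s + queries (K (record_of G s)) G.
Proof. by elim: s K => //= v s IHs K; rewrite IHs. Qed.

Fixpoint explore (l : nat) S (K : transcript -> bool) : qtree n :=
  query_seq (enum S) (fun t =>
    if l is l'.+1 then
      explore l' (S :|: \bigcup_(a <- t) (a.2.1 :|: a.2.2))%SET K
    else Verdict n (K t)).

Lemma expand_record G S :
  (S :|: \bigcup_(a <- record_of G (enum S)) (a.2.1 :|: a.2.2))%SET = expand G S.
Proof. by rewrite big_map big_enum. Qed.

Lemma accepts_explore l S K G :
  accepts (explore l S K) G = K (record_of G (enum (iter l (expand G) S))).
Proof.
elim: l S => [|l IHl] S; rewrite /= accepts_query_seq //.
by rewrite IHl expand_record -iterSr.
Qed.

Lemma queries_explore d l S K G :
  FB d G -> queries (explore l S K) G <= l.+1 * (#|S| * d.*2.+1 ^ l).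
Proof.
move=> FG; elim: l S => [|l IHl] S; rewrite /= queries_query_seq -cardE /=.
  by rewrite addn0 mul1n muln1.
rewrite mulSn leq_add ?leq_pmulr ?expn_gt0 // expand_record.
rewrite (leq_trans (IHl _)) // leq_mul2l expnS mulnA leq_mul2r.
by rewrite card_expand ?orbT.
Qed.

Fixpoint queried (t : qtree n) G : seq 'I_n :=
  if t is Query v K then v :: queried (K (outnbr G v, innbr G v)) G else [::].

Lemma size_queried t G : size (queried t G) = queries t G.
Proof. by elim: t => //= v K IHK; rewrite IHK. Qed.

(** Adaptivity is harmless: equal answers so far lead to the same next query. *)
Lemma accepts_congr t G G' :
  {in queried t G, forall v, outnbr G' v = outnbr G v /\ innbr G' v = innbr G v} ->
  accepts t G' = accepts t G.
Proof.
elim: t => //= v K IHK eqG.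
have [-> ->] := eqG v (mem_head _ _).
by apply: IHK => u uQ; apply: eqG; rewrite inE uQ orbT.
Qed.

End Exploration.

(** * Testability forces a bounded set of obstructions *)

Section Pullback.
Variables (n N : nat) (G : digraph N) (h : 'I_n -> 'I_N).

(** Unlike [induced], this keeps the vertex names of ['I_n], so that its answers can be compared
    with those of another digraph on ['I_n]. *)
Definition pullback_arcs : {set 'I_n * 'I_n} :=
  [set p | (h p.1, h p.2) \in arcs G].

Lemma pullback_loopless : [forall v, (v, v) \notin pullback_arcs].
Proof. by apply/forallP => v; rewrite inE arcs_irrefl. Qed.

Definition pullback : digraph n := Digraph pullback_loopless.

Lemma pullback_embedding : injective h -> embedding pullback G h.
Proof. by split=> // u v; rewrite inE. Qed.

End Pullback.

Lemma embedding_FB d m n (F : digraph m) (G : digraph n) f :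
  embedding F G f -> FB d G -> FB d F.
Proof.
move=> [f_inj Ef] /forallP FG; apply/forallP => v.
have /andP[out_d in_d] := FG (f v).
rewrite -(card_imset (outnbr F v) f_inj) -(card_imset (innbr F v) f_inj).
apply/andP; split; [apply: leq_trans out_d | apply: leq_trans in_d];
by apply/subset_leq_card/fintype.subsetP => _ /imsetP[u + ->]; rewrite !inE Ef.
Qed.

(** [X] collects the vertices to avoid. At most [#|X| + #|W|] targets are blocked, which leaves
    enough for the vertices outside [W]. *)
Lemma extend_injection n N (W : {set 'I_n}) (X : {set 'I_N}) (phi : 'I_#|W| -> 'I_N) :
  injective phi -> n + #|X| <= N ->
  exists h : 'I_n -> 'I_N,
    [/\ injective h, forall i, h (enum_val i) = phi i
      & forall v, v \notin W -> h v \notin (X :|: [set phi i | i : 'I_#|W|])%SET].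
Proof.
move=> phi_inj leN; set Y := (_ :|: _)%SET.
have le_card : #|~: W| <= #|~: Y|.
  have := cardsC W; have := cardsC Y; rewrite !card_ord.
  have : #|Y| <= #|X| + #|W|.
    by rewrite (leq_trans (leq_card_setU _ _)) // card_imset ?card_ord.
  lia.
pose g (j : 'I_#|~: W|) : 'I_N := enum_val (widen_ord le_card j).
have g_inj : injective g by move=> i j /enum_val_inj/(congr1 val)/= /val_inj.
have gY j : g j \notin Y by have := enum_valP (widen_ord le_card j); rewrite inE.
pose R v y := if v \in W then exists2 i, enum_val i = v & y = phi i
              else exists2 j : 'I_#|~: W|, enum_val j = v & y = g j.
have [h hR] : exists h, forall v, R v (h v).
  apply: (fin_all_exists (P := R)) => v; rewrite /R.
  have [vW | ] := boolP (v \in W); last rewrite -finset.in_setC => vW.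
    by exists (phi (enum_rank_in vW v)), (enum_rank_in vW v); rewrite ?enum_rankK_in.
  by exists (g (enum_rank_in vW v)), (enum_rank_in vW v); rewrite ?enum_rankK_in.
have phiY i : phi i \in Y by rewrite inE imset_f ?orbT.
exists h; split=> [u v | i | v vW].
- have := hR u; have := hR v; rewrite /R.
  case: ifP => _ [i <- ->]; case: ifP => _ [j <- ->].
  + by move/phi_inj->.
  + by move=> ji; have := gY j; rewrite ji phiY.
  + by move=> ji; have := gY i; rewrite -ji phiY.
  + by move/g_inj->.
- by have := hR (enum_val i); rewrite /R enum_valP => -[j /enum_val_inj-> ->].
by have := hR v; rewrite /R (negbTE vW) => -[j _ ->].
Qed.

(* A digraph of the property containing the closed neighbourhood of [Q] as an
   induced subgraph need not answer queries to [Q] as [G] does: vertices of [Q]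
   may have further neighbours. There are few of these, so they can be deleted
   if the digraph is a bit larger than [G]. *)
Lemma same_answers d (P : digraph_class) n N (G : digraph n) (G2 : digraph N)
    (Q : seq 'I_n) phi :
  iso_closed P -> hereditary P -> members d P N G2 ->
  embedding (induced G (expand G [set v in Q])) G2 phi ->
  n + size Q * d.*2 <= N ->
  exists2 G4, members d P n G4 &
    {in Q, forall v, outnbr G4 v = outnbr G v /\ innbr G4 v = innbr G v}.
Proof.
move=> isoP herP [FG2 PG2]; set W := expand G _ => -[phi_inj phiE] leN.
pose A := [set phi i | i : 'I_#|W| & enum_val i \in Q]%SET.
pose X := (\bigcup_(y in A) nbrs G2 y :\: [set phi i | i : 'I_#|W|])%SET.
have cardX : #|X| <= size Q * d.*2.
  rewrite (leq_trans (subset_leq_card (finset.subsetDl _ _))) //.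
  rewrite (leq_trans (card_bigcup_nbrs _ FG2)) // leq_mul2r.
  rewrite card_imset // -(card_imset _ enum_val_inj) (leq_trans _ (card_size Q)) ?orbT //.
  by apply/subset_leq_card/fintype.subsetP => _ /imsetP[i + ->]; rewrite inE.
have [|h [h_inj hphi hX]] := extend_injection (X := X) phi_inj.
  by rewrite (leq_trans _ leN) // leq_add2l.
have h_emb := pullback_embedding G2 h_inj.
have QW v : v \in Q -> v \in W.
  by move=> vQ; apply: (fintype.subsetP (expand_self _ _)); rewrite inE.
have NW v w : v \in Q -> w \in nbrs G v -> w \in W.
  by move=> vQ; apply: expand_nbr; rewrite inE.
have hE u v : u \in W -> v \in W -> ((h u, h v) \in arcs G2) = ((u, v) \in arcs G).
  move=> uW vW; rewrite -(enum_rankK_in uW uW) -(enum_rankK_in uW vW).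
  by rewrite !hphi phiE inE.
(* As [h] avoids [X], the pullback gives queried vertices no neighbours outside [W]. *)
have hN v w : v \in Q -> h w \in nbrs G2 (h v) -> w \in W.
  move=> vQ hw; apply: contraLR hw => /hX; rewrite inE negb_or => /andP[hwX hwphi].
  apply: contra hwX => hw; rewrite inE hwphi; apply/finset.bigcupP.
  exists (h v) => //; have vW := QW v vQ; apply/imsetP.
  by exists (enum_rank_in vW v); rewrite ?inE -?hphi enum_rankK_in.
exists (pullback G2 h).
  by split; [apply: embedding_FB h_emb FG2 | apply: hereditary_embedding h_emb PG2].
move=> v vQ; split; apply/setP => w; rewrite !inE /=.
  have [wW | /negP wW] := boolP (w \in W); first by rewrite hE ?(QW v vQ).
  by apply/idP/idP => vw; case: wW; [apply: (hN v) | apply: (NW v)];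
    rewrite // mem_nbrs vw.
have [wW | /negP wW] := boolP (w \in W); first by rewrite hE ?(QW v vQ).
by apply/idP/idP => vw; case: wW; [apply: (hN v) | apply: (NW v)];
  rewrite // mem_nbrs vw orbT.
Qed.

Definition obstructions (d : nat) (P : digraph_class) (r : nat) : digraph_class :=
  fun k F => k <= r /\ exists N0, forall N (G : digraph N) f,
    N0 < N -> members d P N G -> ~ embedding F G f.

(** The bound [N0] of an obstruction depends on it, but only finitely many digraphs have at most [r]
    vertices, so the maximum serves all. *)
Lemma obstructions_threshold d P r :
  exists nstar, forall k (F : digraph k), obstructions d P r F ->
    forall N (G : digraph N) f,
      nstar < N -> members d P N G -> ~ embedding F G f.
Proof.
pose excluded k (F : digraph k) N0 := forall N (G : digraph N) f,
  N0 < N -> members d P N G -> ~ embedding F G f.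
pose T : finType := {k : 'I_r.+1 & digraph k}.
have [N0 N0P] : exists N0 : T -> nat, forall x : T,
    obstructions d P r (tagged x) -> excluded _ (tagged x) (N0 x).
  apply: (fin_all_exists (P := fun (x : T) N => obstructions d P r (tagged x) ->
    excluded _ (tagged x) N)) => x.
  have [[_ [N NP]] | nobs] := pselect (obstructions d P r (tagged x)).
    by exists N.
  by exists 0.
exists (\max_x N0 x) => k F obsF N G f ltN.
have le_kr : k < r.+1 by case: obsF.
pose x : T := existT _ (Ordinal le_kr) F.
apply: (N0P x obsF); apply: leq_ltn_trans ltN; exact: (leq_bigmax (F := N0) x).
Qed.

Local Open Scope ring_scope.

Section Probability.
Variables (R : realType) (n : nat) (A : rand_alg R n).

Lemma prob_accept_reject (G : digraph n) : prob_accept A G + prob_reject A G = 1.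
Proof.
rewrite -(weight_sum1 A) (bigID (fun w => accepts (strategy A w) G)) /=.
by congr (_ + _); apply: eq_bigl.
Qed.

(** Brings one-sidedness down to single runs: rejecting runs have nonnegative weights with sum
    zero. *)
Lemma sure_accept (G : digraph n) w :
  prob_accept A G = 1 -> 0 < weight A w -> accepts (strategy A w) G.
Proof.
move=> acc1 w_gt0; apply: contraT => rej.
have rej0 : prob_reject A G = 0.
  by apply: (addrI 1); rewrite -{1}acc1 prob_accept_reject addr0.
have := psumr_eq0P (fun v _ => weight_ge0 v) rej0 rej.
by move=> w0; rewrite w0 ltxx in w_gt0.
Qed.

Lemma likely_reject (G : digraph n) :
  0 < prob_reject A G ->
  exists2 w, ~~ accepts (strategy A w) G & 0 < weight A w.
Proof.
move=> rej; have [/existsP[w /andP[]] | ] :=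
    boolP [exists w, ~~ accepts (strategy A w) G && (0 < weight A w)].
  by exists w.
rewrite negb_exists => /forallP none.
move: rej; rewrite /prob_reject big1 ?ltxx // => w rejw.
apply/eqP; have := none w.
by rewrite rejw /= -leNgt eq_le weight_ge0 andbT.
Qed.

End Probability.

Lemma eps_close_le (R : realType) d (e e' : R) n (G G' : digraph n) :
  e <= e' -> eps_close d e G G' -> eps_close d e' G G'.
Proof.
by move=> le_ee'; rewrite /eps_close => /le_trans; apply; rewrite !ler_wpM2r.
Qed.

Lemma edit_dist_refl n (G : digraph n) : edit_dist G G = 0%N.
Proof. by rewrite /edit_dist finset.setDv finset.setU0 cards0. Qed.

Lemma edit_dist_trans n (G1 G2 G3 : digraph n) :
  (edit_dist G1 G3 <= edit_dist G1 G2 + edit_dist G2 G3)%N.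
Proof.
apply: leq_trans (leq_card_setU _ _).
apply/subset_leq_card/fintype.subsetP => p; rewrite !inE.
by case: (p \in arcs G1); case: (p \in arcs G2); case: (p \in arcs G3).
Qed.

Lemma testable_obstructions (R : realType) d (P : digraph_class) :
  iso_closed P -> hereditary P -> one_sided_strongly_testable R d P ->
  forall eps : R, 0 < eps ->
    exists (r nstar : nat) (H : digraph_class), r_set r H /\
      forall n : nat, (nstar < n)%N ->
        (members d P n `<=` free_members d H n)%classic /\
        close_sets d (eps / 2) (free_members d H n) (members d P n).
Proof.
move=> isoP herP testP eps eps_gt0.
(* Tests are only given for parameters below 1, whereas [eps] is arbitrary. *)
have [eps' [eps'01 eps'_le]] : exists eps', 0 < eps' < 1 /\ eps' <= eps / 2.
  exists (Num.min (eps / 2) (1 / 2)).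
  have half_lt1 : 1 / 2 < 1 :> R by rewrite ltr_pdivrMr // mul1r ltr1n.
  by rewrite ge_min lexx lt_min gt_min half_lt1 orbT !divr_gt0 ?ltr01.
have [q testq] := testP _ eps'01.
(* Bounds the closed neighbourhood of [q] queried vertices. *)
pose r := (q * d.*2.+1)%N; pose H := obstructions d P r.
have [nstar nstarP] := obstructions_threshold d P r.
exists r, nstar, H; split=> [k F [] // | n lt_n].
have PH : (members d P n `<=` free_members d H n)%classic.
  move=> G PG; split; first by case: PG.
  by apply/induced_freeP => k F f HF; apply: nstarP HF _ _ _ lt_n PG.
split=> //; split=> G; last first.
  move=> PG; exists G; first exact: PH.
  by rewrite /eps_close edit_dist_refl !mulr_ge0 ?invr_ge0 ?ler0n // ltW.
move=> [FG /induced_freeP freeG]; apply: contrapT => far.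
have [A [boundA [accA rejA]]] := testq n.
have farG : far_from d eps' G (members d P n).
  by move=> [G' PG' /(eps_close_le eps'_le) close]; apply: far; exists G'.
have [|w rejw w_gt0] := @likely_reject R n A G.
  by apply: lt_le_trans (rejA G FG farG); rewrite divr_gt0.
pose Q := queried (strategy A w) G; pose W := expand G [set v in Q]%SET.
have sizeQ : (size Q <= q)%N by rewrite size_queried boundA.
have cardW : (#|W| <= r)%N.
  rewrite (leq_trans (card_expand _ FG)) // leq_mul2r /=.
  rewrite (leq_trans _ sizeQ) // (leq_trans _ (card_size Q)) //.
  by apply/subset_leq_card/fintype.subsetP => v; rewrite inE.
have nobs : ~ H _ (induced G W).
  by move=> HF; apply: freeG HF (induced_embedding G W).
have [N [G2 [phi [ltN PG2 Wphi]]]] : exists N (G2 : digraph N) phi,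
    [/\ (n + q * d.*2 < N)%N, members d P N G2 & embedding (induced G W) G2 phi].
  apply: contrapT => none; apply: nobs; split=> //.
  exists (n + q * d.*2)%N => N G2 f ltN PG2 Wf.
  by apply: none; exists N, G2, f.
have [|G4 PG4 eqQ] := same_answers isoP herP PG2 Wphi.
  by rewrite (leq_trans _ (ltnW ltN)) // leq_add2l leq_mul2r sizeQ orbT.
by move: rejw; rewrite -(accepts_congr eqQ) sure_accept // accA.
Qed.

Local Close Scope ring_scope.

(** * Rare and common ball types *)

(** Each of the [#|T|] classes that meets the rare set has size times [M] below [m]. *)
Lemma card_rare (V T : finType) (ty : V -> T) m M :
  #|[set v | #|[set w | ty w == ty v]| * M < m]%SET| * M <= #|T| * m.
Proof.
set B := finset _.
rewrite -sum1_card (partition_big ty xpredT) //= big_distrl /= -sum_nat_const.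
apply: leq_sum => t _; rewrite sum1dep_card.
have [-> | [v]] := set_0Vmem [set v in B | ty v == t]%SET; first by rewrite cards0.
rewrite !inE => /andP[lt_m /eqP <-]; apply: leq_trans (ltnW lt_m).
rewrite leq_mul2r; apply/orP; right; apply/subset_leq_card.
by apply/fintype.subsetP => w; rewrite !inE => /andP[].
Qed.

Section BallType.
Variables (n d L : nat).
Implicit Types (G : digraph n) (S : {set 'I_n}).

Local Notation word := (L.-tuple 'I_d.*2.+1).

(* Vertices of equal type have isomorphic rooted [L]-balls: sending the vertex
   reached by a word to the vertex reached by the same word is well defined. *)
Definition ball_type G v : {ffun word * word -> bool * bool} :=
  [ffun p : word * word => (node G v p.1 == node G v p.2 :> 'I_n,
              (node G v p.1, node G v p.2) \in arcs G)].

Definition rare M G : {set 'I_n} :=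
  [set v | #|[set w | ball_type G w == ball_type G v]| * M < n]%SET.

Lemma ball_typeE G v w (x y : word) : ball_type G v = ball_type G w ->
  ((node G v x == node G v y) = (node G w x == node G w y)) *
  (((node G v x, node G v y) \in arcs G) = ((node G w x, node G w y) \in arcs G)).
Proof. by move=> /ffunP/(_ (x, y)); rewrite !ffunE => -[-> ->]. Qed.

(** Arcs rather than vertices are removed, so the result is still an [n]-vertex digraph at finite
    edit distance from [G]. *)
Definition isolate_arcs G S : {set 'I_n * 'I_n} :=
  [set p in arcs G | (p.1 \notin S) && (p.2 \notin S)].

Lemma isolate_loopless G S : [forall v, (v, v) \notin isolate_arcs G S].
Proof. by apply/forallP => v; rewrite inE arcs_irrefl. Qed.

Definition isolate G S : digraph n := Digraph (isolate_loopless G S).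

Lemma isolateE G S u v :
  ((u, v) \in arcs (isolate G S)) = [&& (u, v) \in arcs G, u \notin S & v \notin S].
Proof. by rewrite inE. Qed.

Lemma isolate_FB G S : FB d G -> FB d (isolate G S).
Proof.
move=> /forallP FG; apply/forallP => v; have /andP[out_d in_d] := FG v.
apply/andP; split; [apply: leq_trans out_d | apply: leq_trans in_d];
by apply/subset_leq_card/fintype.subsetP => w; rewrite !inE => /and3P[].
Qed.

Lemma isolate_edit_dist G S : FB d G -> edit_dist G (isolate G S) <= #|S| * d.*2.
Proof.
move=> /forallP FG; rewrite -sum_nat_const.
pose E v := ([set (v, w) | w in outnbr G v] :|: [set (w, v) | w in innbr G v])%SET.
apply: (@leq_trans #|\bigcup_(v in S) E v|).
  apply/subset_leq_card/fintype.subsetP => -[u v]; rewrite !inE /=.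
  have [uv | _] /= := boolP ((u, v) \in arcs G); last by [].
  rewrite andbT orbF -negb_or negbK => /orP[uS | vS]; apply/finset.bigcupP.
    by exists u => //; rewrite inE imset_f // inE.
  by exists v => //; rewrite inE orbC (imset_f (fun w => (w, v))) // inE.
elim/big_rec2: _ => [|v m A _ Am]; first by rewrite cards0.
rewrite (leq_trans (leq_card_setU _ _)) // leq_add //.
rewrite (leq_trans (leq_card_setU _ _)) // -addnn.
have /andP[out_d in_d] := FG v.
by rewrite leq_add // (leq_trans (leq_imset_card _ _)).
Qed.

Lemma word_expand G S v (x : word) :
  v \in S -> node G v x \in iter L (expand G) S.
Proof. by move=> /(node_expand G x); rewrite size_tuple. Qed.

Lemma word_expand_rev G S v (x : word) l :
  node G v x \in iter l (expand G) S -> v \in iter (L + l) (expand G) S.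
Proof. by move/node_expand_rev; rewrite size_tuple. Qed.

(** The radius [L + L + 1] ensures that the [L]-balls around vertices that are not near are disjoint
    and joined by no arc. *)
Definition near G v w := w \in iter (L + L).+1 (expand G) [set v]%SET.

Lemma not_near G v w (x y : word) : ~~ near G v w ->
  node G w y != node G v x /\ node G w y \notin nbrs G (node G v x).
Proof.
move=> far; suff : node G w y \notin expand G [set node G v x]%SET.
  rewrite inE negb_or !inE => /andP[-> notin]; split=> //.
  by apply: contra notin => vw; apply/finset.bigcupP; exists (node G v x); rewrite ?inE.
apply: contra far => vw; rewrite /near -addnS.
apply: (word_expand_rev (x := y)).
have sub :
    [set node G v x]%SET \subset iter L (expand G) [set v]%SET.
  by rewrite finset.sub1set word_expand // inE.
exact: (fintype.subsetP (iter_expand_mono G 1 sub)) vw.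
Qed.

Lemma path_node m (F : digraph m) G (f : 'I_m -> 'I_n) a p : FB d G ->
  (forall u v, v \in nbrs F u -> f v \in nbrs G (f u)) ->
  path [rel u v | v \in nbrs F u] a p ->
  exists2 x : seq 'I_d.*2.+1, size x = size p & node G (f a) x = f (last a p).
Proof.
move=> FG hom; elim: p a => [|b p IHp] a /=; first by exists [::].
move=> /andP[ab /IHp[x sz_x xE]].
by have [i iE] := port_surj FG (hom _ _ ab); exists (i :: x); rewrite /= ?sz_x ?iE.
Qed.

Lemma connect_node m (F : digraph m) G (f : 'I_m -> 'I_n) a b : FB d G -> m <= L ->
  (forall u v, v \in nbrs F u -> f v \in nbrs G (f u)) ->
  connect [rel u v | v \in nbrs F u] a b ->
  exists x : word, node G (f a) x = f b.
Proof.
move=> FG le_mL hom /connectP[p0 p0_path ->].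
case/shortenP: p0_path => p p_path p_uniq _.
have [x sz_x xE] := path_node FG hom p_path.
(* A path without repetitions has fewer than [m <= L] arcs; the last port stays put and pads the
   word to length exactly [L]. *)
have sz : size (x ++ nseq (L - size x) ord_max) == L.
  have := max_card (mem (a :: p)); rewrite (card_uniqP p_uniq) card_ord /= => lt_p.
  by rewrite size_cat size_nseq sz_x subnKC // (leq_trans (ltnW lt_p)).
by exists (Tuple sz); rewrite node_cat xE node_stay.
Qed.

(* Each component of [F] is moved into the ball around the vertex [w] of its
   root. Components avoiding the rare vertices are copied by the isomorphism of
   balls; all others are single vertices, which can be moved anywhere. *)
Lemma transplant m (F : digraph m) G M (f w : 'I_m -> 'I_n) :
  FB d G -> m <= L -> embedding F (isolate G (rare M G)) f ->
  (forall i, f i \notin rare M G -> ball_type G (w i) = ball_type G (f i)) ->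
  (forall i j : 'I_m, i < j -> ~~ near G (w i) (w j)) ->
  exists2 g, embedding F G g &
    forall u, exists i, g u \in iter L (expand G) [set w i]%SET.
Proof.
move=> FG le_mL [f_inj fE] w_type w_far.
pose e := [rel u v | v \in nbrs F u].
have hom' u v : v \in nbrs F u -> f v \in nbrs (isolate G (rare M G)) (f u).
  by rewrite !mem_nbrs !fE.
have hom u v : v \in nbrs F u -> f v \in nbrs G (f u).
  by move/hom'; rewrite !mem_nbrs !isolateE => /orP[] /and3P[->]; rewrite ?orbT.
have e_sym : connect_sym e by apply: sym_connect_sym => u v; apply: nbrs_sym.
(* A vertex incident with an arc after isolation is not rare, so rare vertices form singleton
   components. *)
have common u v : connect e u v -> u != v -> f u \notin rare M G.
  move=> /connectP[[|c p] /= + ->]; first by rewrite eqxx.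
  by move=> /andP[/hom']; rewrite mem_nbrs !isolateE => /orP[] /and3P[].
have [x xE] : exists x : 'I_m -> word, forall u, node G (f (fingraph.root e u)) (x u) = f u.
  apply: (fin_all_exists (P := fun u (x : word) =>
    node G (f (fingraph.root e u)) x = f u)) => u.
  have con : connect e (fingraph.root e u) u by rewrite e_sym connect_root.
  exact: connect_node con.
(* The word leading from the root's image to [f u] is replayed from the new root. *)
pose g u := node G (w (fingraph.root e u)) (x u).
have gE u v : fingraph.root e u = fingraph.root e v ->
    ((g u == g v) = (f u == f v)) *
    (((g u, g v) \in arcs G) = ((f u, f v) \in arcs (isolate G (rare M G)))).
  have [-> _ | neq_uv root_uv] := eqVneq u v; first by rewrite !eqxx !arcs_irrefl.
  have con_uv : connect e u v by rewrite -root_connect // root_uv.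
  have u_common := common u v con_uv neq_uv.
  have v_common : f v \notin rare M G by apply: (common v u); rewrite 1?eq_sym // e_sym.
  have r_common : f (fingraph.root e u) \notin rare M G.
    have [ru | ] := eqVneq (fingraph.root e u) u; first by rewrite ru.
    by apply: common; rewrite e_sym connect_root.
  rewrite /g -root_uv !(ball_typeE _ _ (w_type _ r_common)) xE root_uv xE.
  by rewrite isolateE u_common v_common !andbT.
(* Distinct components land in balls with no arc between them, as an induced copy requires. *)
have gF u v : fingraph.root e u != fingraph.root e v -> g u != g v /\ g v \notin nbrs G (g u).
  rewrite neq_ltn => /orP[] /w_far far.
    by have [? ?] := not_near (x u) (x v) far; rewrite eq_sym.
  by have [? ?] := not_near (x v) (x u) far; rewrite nbrs_sym.
exists g; last first.
  move=> u; exists (fingraph.root e u).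
  by apply: word_expand; rewrite inE.
split=> [u v /eqP guv | u v].
  have [ruv | /gF[/negP]] // := eqVneq (fingraph.root e u) (fingraph.root e v).
  by apply: f_inj; apply/eqP; rewrite -gE.
have [ruv | ruv] := eqVneq (fingraph.root e u) (fingraph.root e v); first by rewrite gE // fE.
have [_] := gF u v ruv; rewrite mem_nbrs negb_or => /andP[/negbTE-> _].
apply/esym/negbTE; apply: contra ruv => uv.
by rewrite root_connect // connect1 //= mem_nbrs uv.
Qed.

End BallType.

(** * Counting *)

Section Spread.
Variables (V : finType) (S : nat -> {set V}) (near : rel V).

Fixpoint spread (s : seq V) : bool :=
  if s is w :: s' then
    [&& w \in S (size s'), all (fun v => ~~ near v w) s' & spread s']
  else true.

(* A sequence is built from its tail, hence its [j]-th choice is [nth _ (rev s) j]. *)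
Lemma spread_nth s v0 : spread s ->
  (forall j, j < size s -> nth v0 (rev s) j \in S j) /\
  (forall i j, i < j < size s -> ~~ near (nth v0 (rev s) i) (nth v0 (rev s) j)).
Proof.
elim: s => [|w s IHs] /=; first by split=> // i j; rewrite ltn0 andbF.
move=> /and3P[wS /allP far /IHs[sS s_far]]; rewrite rev_cons; split=> [j | i j].
  rewrite ltnS leq_eqVlt nth_rcons size_rev => /orP[/eqP -> | lt_j].
    by rewrite ltnn eqxx.
  by rewrite lt_j sS.
move=> /andP[lt_ij]; rewrite ltnS leq_eqVlt !nth_rcons size_rev.
move=> /orP[/eqP ej | lt_j].
  by rewrite -ej lt_ij ltnn eqxx far // -mem_rev mem_nth // size_rev -ej.
by rewrite lt_j (ltn_trans lt_ij lt_j) s_far // lt_ij.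
Qed.

(** Greedy choice: fewer than [r] earlier choices exclude at most [D] candidates each, so at least
    [c] remain at every stage. *)
Lemma card_spread r c D m :
  (forall v, #|[set w | near v w]%SET| <= D) ->
  (forall j, c + r * D <= #|S j|) -> m <= r ->
  c ^ m <= #|[set t : m.-tuple V | spread t]%SET|.
Proof.
move=> nearD cS; elim: m => [|m IHm] lt_mr.
  by rewrite expn0 card_gt0; apply/set0Pn; exists [tuple]; rewrite inE.
pose A (t : m.-tuple V) := [set w in S m | all (fun v => ~~ near v w) t]%SET.
have cA t : c <= #|A t|.
  have sub : S m \subset (A t :|: \bigcup_(v <- t) [set w | near v w])%SET.
    apply/fintype.subsetP => w wS; rewrite !inE wS /=.
    have [// | /allPn[v vt]] := boolP (all _ _); rewrite negbK => vw /=.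
    by rewrite (big_rem v vt) /= !inE vw.
  have le_D (s : seq V) : #|\bigcup_(v <- s) [set w | near v w]%SET| <= size s * D.
    elim: s => [|v s IHs]; first by rewrite big_nil cards0.
    by rewrite big_cons (leq_trans (leq_card_setU _ _)) // mulSn leq_add.
  have := leq_trans (subset_leq_card sub) (leq_card_setU _ _).
  have := le_D t; have := cS m; rewrite size_tuple.
  have : m * D <= r * D by rewrite leq_mul2r (ltnW lt_mr) orbT.
  lia.
pose X := [set p : m.-tuple V * V | spread p.1 && (p.2 \in A p.1)]%SET.
pose ext (p : m.-tuple V * V) : m.+1.-tuple V := [tuple of p.2 :: p.1].
have ext_inj : injective ext.
  by move=> [t w] [t' w'] /(congr1 val) /= [-> /val_inj ->].
rewrite expnSr; apply: (@leq_trans #|X|).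
  have -> : #|X| = \sum_(t : m.-tuple V | spread t) \sum_(w in A t) 1.
    by rewrite pair_big_dep /= sum1dep_card.
  rewrite (leq_trans (leq_mul (IHm (ltnW lt_mr)) (leqnn c))) //.
  rewrite -sum1dep_card big_distrl /=; apply: leq_sum => t _.
  by rewrite mul1n sum1_card.
rewrite -(card_imset _ ext_inj); apply/subset_leq_card/fintype.subsetP => _ /imsetP[[t w] + ->].
by rewrite !inE /= size_tuple => /andP[-> /andP[-> ->]].
Qed.

End Spread.

(** Bernoulli's inequality for [(1 + 1/a) ^ m], cleared of denominators. *)
Lemma bernoulli_nat a m : a ^ m * (a + m) <= a * a.+1 ^ m.
Proof.
elim: m => [|m IHm]; first by rewrite !expn0 addn0 muln1 mul1n.
rewrite expnS (expnS a.+1); move: (a ^ m) (a.+1 ^ m) IHm => x y IHm.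
nia.
Qed.

(** This is [(1 - 1/K) ^ K <= 1/2], from Bernoulli with [a = K - 1] and [m = K]. *)
Lemma half_power K : 0 < K -> 2 * K.-1 ^ K <= K ^ K.
Proof.
case: K => [//|a] _ /=; have := bernoulli_nat a a.+1.
case: a => [|a]; first by rewrite exp0n.
move: (a.+1 ^ a.+2) (a.+2 ^ a.+2) => x y; nia.
Qed.

(* [K] independent trials, each hitting [good] with probability at least [1/K]. *)
Lemma few_misses (T : finType) (good : {set T}) K : 0 < K -> #|T| <= #|good| * K ->
  2 * #|[set w : {ffun 'I_K -> T} | [forall i, w i \notin good]]%SET| <= #|{ffun 'I_K -> T}|.
Proof.
move=> K_gt0 goodK.
have -> : #|[set w : {ffun 'I_K -> T} | [forall i, w i \notin good]]%SET|
    = #|~: good| ^ K.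
  rewrite -[in RHS](card_ord K) -card_ffun_on; apply: eq_card => w; rewrite inE.
  by apply/forallP/ffun_onP => miss i; have := miss i; rewrite inE.
rewrite card_ffun card_ord.
have missK : #|~: good| * K <= K.-1 * #|T|.
  by have := cardsC good; move: goodK K_gt0; case: K => // K; nia.
rewrite -(@leq_pmul2r (K ^ K)) ?expn_gt0 ?K_gt0 // -mulnA -expnMn.
apply: (@leq_trans (2 * (K.-1 * #|T|) ^ K)); first by rewrite leq_mul2l leq_exp2r.
by rewrite expnMn mulnA mulnC leq_mul2l half_power ?orbT.
Qed.

(** * The tester *)

(** Copies are confined to queried vertices: elsewhere [revealed] may lack arcs of the input, and a
    copy could be spurious. *)
Definition in_transcript (H : digraph_class) n (t : transcript n) : Prop :=
  exists k (F : digraph k) f,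
    [/\ H k F, embedding F (revealed t) f & forall u, f u \in map fst t].

Lemma in_transcript_record (H : digraph_class) n (G : digraph n) (s : seq 'I_n) :
  in_transcript H (record_of G s) <->
  exists k (F : digraph k) f, [/\ H k F, embedding F G f & forall u, f u \in s].
Proof.
have fst_record : map fst (record_of G s) = s by rewrite -map_comp map_id.
rewrite /in_transcript fst_record.
by split=> -[k [F [f [HF [f_inj fE] fs]]]]; exists k, F, f; split=> //;
  split=> // u v; rewrite -fE revealedE.
Qed.

Section Uniform.
Variables (R : realType) (n : nat) (T : finType).
Hypothesis T_gt0 : 0 < #|T|.
Variable strat : T -> qtree n.

Local Open Scope ring_scope.

Lemma uniform_ge0 (w : T) : 0 <= #|T|%:R^-1 :> R.
Proof. by rewrite invr_ge0 ler0n. Qed.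

Lemma uniform_sum1 : \sum_(w : T) #|T|%:R^-1 = 1 :> R.
Proof. by rewrite sumr_const -[_ *+ _]mulr_natl mulfV // pnatr_eq0 -lt0n. Qed.

Definition uniform : rand_alg R n := RandAlg uniform_ge0 uniform_sum1 strat.

Lemma uniform_accept (G : digraph n) :
  (forall w, accepts (strat w) G) -> prob_accept uniform G = 1.
Proof.
by move=> acc; rewrite -uniform_sum1; apply: eq_bigl => w; rewrite /= acc.
Qed.

Lemma uniform_reject (G : digraph n) :
  (2 * #|[set w | accepts (strat w) G]%SET| <= #|T|)%N ->
  1 / 2 <= prob_reject uniform G.
Proof.
set a := #|_| => le_a.
have -> : prob_reject uniform G = (#|T| - a)%:R / #|T|%:R.
  rewrite /prob_reject /= sumr_const -[_ *+ _]mulr_natl; congr (_%:R * _).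
  rewrite -(cardsC [set w | accepts (strat w) G]%SET) -/a addKn.
  by apply: eq_card => w; rewrite !inE.
rewrite ler_pdivlMr ?ltr0n // mulrAC ler_pdivrMr ?ltr0n // mul1r -natrM ler_nat.
lia.
Qed.

End Uniform.

(** Handles the finitely many small [n], where the obstructions say nothing: all vertices are
    queried. *)
Lemma full_test (R : realType) d (P : digraph_class) (eps : R) n : (0 <= eps)%R ->
  exists A : rand_alg R n, query_bound d n A /\ one_sided_test d eps P A.
Proof.
move=> eps_ge0.
pose t := query_seq (enum 'I_n) (fun t => Verdict n `[< P n (revealed t) >]).
have tE G : accepts t G = `[< P n G >].
  rewrite accepts_query_seq /=; congr `[< P n _ >].
  by apply/val_inj/setP => -[u v]; rewrite revealedE ?mem_enum.
have unit_gt0 : 0 < #|{: unit}| by rewrite card_unit.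
exists (uniform R unit_gt0 (fun=> t)); split; [|split].
- by move=> w G _; rewrite /= queries_query_seq addn0 size_enum_ord.
- by move=> G [_ PG]; apply: uniform_accept => _; rewrite tE; apply/asboolP.
move=> G FG far; apply: uniform_reject; rewrite card_unit.
rewrite (_ : [set _ | _]%SET = finset.set0) ?cards0 //.
apply/setP => w; rewrite !inE tE; apply/asboolP => PG; apply: far; exists G => //.
by rewrite /eps_close edit_dist_refl !mulr_ge0 ?ler0n.
Qed.

Section Sampling.
Variables (R : realType) (d r M n : nat) (H : digraph_class).
Arguments H : clear implicits.
Hypotheses (rH : r_set r H) (M_gt0 : 0 < M) (n_gt0 : 0 < n).
Hypothesis n_large : 2 * M * (r * d.*2.+1 ^ (r + r).+1).+1 <= n.

(** A random [r]-tuple will be good with probability at least [1 / (2 * M) ^ r], so [K] independent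
    tuples miss with probability at most 1/2. *)
Let K := (2 * M) ^ r.
Let Omega : finType := {ffun 'I_K -> r.-tuple 'I_n}.

Let sample (w : Omega) : {set 'I_n} :=
  (\bigcup_(i : 'I_K) [set v in (w i : r.-tuple 'I_n)])%SET.

Let strat (w : Omega) : qtree n :=
  explore r (sample w) (fun t => ~~ `[< in_transcript H t >]).

Let K_gt0 : 0 < K. Proof. by rewrite expn_gt0 muln_gt0 M_gt0. Qed.

Let Omega_gt0 : 0 < #|Omega|.
Proof. by rewrite card_ffun card_tuple !card_ord !expn_gt0 n_gt0. Qed.

Definition sampling_test : rand_alg R n := uniform R Omega_gt0 strat.

Lemma sampling_queries :
  query_bound d (r.+1 * (K * r * d.*2.+1 ^ r)) sampling_test.
Proof.
move=> w G FG; apply: leq_trans (queries_explore _ _ _ FG) _.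
rewrite leq_mul2l /= leq_mul2r; apply/orP; right.
rewrite -[K in K * r]card_ord -sum_nat_const /sample.
elim/big_rec2: _ => [|i m S _ Sm]; first by rewrite cards0.
rewrite (leq_trans (leq_card_setU _ _)) // leq_add // cardsE.
by rewrite (leq_trans (card_size _)) // size_tuple.
Qed.

Lemma strat_acceptP w (G : digraph n) :
  reflect (~ exists k (F : digraph k) f,
      [/\ H k F, embedding F G f & forall u, f u \in iter r (expand G) (sample w)])
    (accepts (strat w) G).
Proof.
rewrite accepts_explore; apply: (iffP negP) => nin.
  move=> [k [F [f [HF Ff fS]]]]; apply: nin; apply/asboolP/in_transcript_record.
  by exists k, F, f; split=> // u; rewrite mem_enum.
move=> /asboolP/in_transcript_record[k [F [f [HF Ff fS]]]].
by apply: nin; exists k, F, f; split=> // u; rewrite -mem_enum.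
Qed.

Lemma sampling_accept (G : digraph n) :
  induced_free H G -> prob_accept sampling_test G = 1%R.
Proof.
move=> /induced_freeP freeG; apply: uniform_accept => w; apply/strat_acceptP.
by move=> [k [F [f [HF Ff _]]]]; apply: freeG HF Ff.
Qed.

Lemma sampling_reject (G : digraph n) :
  FB d G -> ~ induced_free H (isolate G (rare d r M G)) ->
  (1 / 2 <= prob_reject sampling_test G)%R.
Proof.
move=> FG nfree; apply: uniform_reject.
have [k [F [f [HF Ff]]]] : exists k (F : digraph k) f,
    H k F /\ embedding F (isolate G (rare d r M G)) f.
  apply: contrapT => none; apply/nfree/induced_freeP => k F f HF Ff.
  by apply: none; exists k, F, f.
have le_kr := rH HF.
(* Admissible samples for vertex [j] of [F]. Rare images impose no constraint, nor do indices from
   [k] on, which only fill up the [r]-tuple. *)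
pose S j := if insub j is Some i then
    if f (i : 'I_k) \in rare d r M G then [set: 'I_n]%SET
    else [set v | ball_type d r G v == ball_type d r G (f i)]%SET
  else [set: 'I_n]%SET.
have S_large j : n <= #|S j| * M.
  rewrite /S; case: insub => [i|]; last by rewrite cardsT card_ord leq_pmulr.
  case: ifPn => [_|]; first by rewrite cardsT card_ord leq_pmulr.
  by rewrite inE -leqNgt.
pose D := d.*2.+1 ^ (r + r).+1; pose c := (n %/ (2 * M)).+1.
have nearD v : #|[set w | near r G v w]%SET| <= D.
  have := card_iter_expand [set v]%SET (r + r).+1 FG; rewrite cards1 mul1n.
  by apply: leq_trans; apply/subset_leq_card/fintype.subsetP => w; rewrite inE.
(* [S j] has at least [n / M] elements; [n_large] bounds [r * D + 1] by [n / (2 * M)], where the 1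
   pays for rounding up in [c]. *)
have cS j : c + r * D <= #|S j|.
  have := S_large j; have := leq_trunc_div n (2 * M); rewrite /c.
  move: n_large; rewrite -/D; move: (r * D) (n %/ (2 * M)) #|S j| => a b s.
  nia.
pose good := [set t : r.-tuple 'I_n | spread S (near r G) t]%SET.
have good_large : #|{: r.-tuple 'I_n}| <= #|good| * K.
  rewrite card_tuple card_ord.
  apply: (@leq_trans (c ^ r * K)).
    (* The rounding in [c] gives [n < c * (2 * M)]. *)
    rewrite /K; case: (posnP r) => [-> // | r_gt0]; rewrite -expnMn leq_exp2r //.
    by rewrite ltnW // -ltn_divLR ?muln_gt0.
  by rewrite leq_mul2r (card_spread nearD cS) ?orbT.
apply: leq_trans (few_misses K_gt0 good_large); rewrite leq_mul2l /=.
apply/subset_leq_card/fintype.subsetP => w; rewrite !inE => /strat_acceptP acc.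
apply/forallP => i; apply/negP; rewrite inE => w_good; apply: acc.
pose v0 : 'I_n := Ordinal n_gt0.
have [w_in w_far] := spread_nth v0 w_good; rewrite size_tuple in w_in w_far.
(* Reversed because [spread] counts choices from the tail; only the first [k] are used. *)
pose x (j : 'I_k) := nth v0 (rev (w i)) j.
have lt_r (j : 'I_k) : j < r by apply: leq_trans le_kr.
have [j | j j' lt_jj' | g Fg gE] := transplant (w := x) FG le_kr Ff.
- move=> j_common; have := w_in j (lt_r j).
  by rewrite /S valK (negbTE j_common) inE => /eqP.
- by apply: w_far; rewrite lt_jj' lt_r.
exists k, F, g; split=> // u; have [j gj] := gE u.
apply: (fintype.subsetP (iter_expand_mono G r _)) gj.
rewrite finset.sub1set; apply/finset.bigcupP; exists i => //.
by rewrite inE -mem_rev mem_nth // size_rev size_tuple.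
Qed.

End Sampling.

(** The distance budget is split: isolating the rare vertices costs at most [eps / 2], and closeness
    of the [H]-free result to the property costs the other half. *)
Lemma obstructions_testable (R : realType) d (P : digraph_class) :
  (forall eps : R, (0 < eps)%R ->
    exists (r nstar : nat) (H : digraph_class), r_set r H /\
      forall n : nat, nstar < n ->
        (members d P n `<=` free_members d H n)%classic /\
        close_sets d (eps / 2) (free_members d H n) (members d P n)) ->
  one_sided_strongly_testable R d P.
Proof.
move=> obsP eps /andP[eps_gt0 _].
have [r [nstar [H [rH PH]]]] := obsP eps eps_gt0.
pose T : finType := {ffun r.-tuple 'I_d.*2.+1 * r.-tuple 'I_d.*2.+1 -> bool * bool}.
pose M := (Num.bound (4 * #|T|%:R / eps)%R).+1.
pose n1 := maxn nstar (2 * M * (r * d.*2.+1 ^ (r + r).+1).+1).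
(* The sum covers both regimes: at most [n1] queries for small [n], the sampling bound for large
   [n]. *)
exists (n1 + r.+1 * ((2 * M) ^ r * r * d.*2.+1 ^ r)) => n.
have [le_n | lt_n] := leqP n n1.
  have [A [boundA testA]] := full_test d P n (ltW eps_gt0).
  exists A; split=> // w G FG; apply: leq_trans (boundA w G FG) _.
  by rewrite (leq_trans le_n) // leq_addr.
have [lt_nstar n_large] : nstar < n /\ 2 * M * (r * d.*2.+1 ^ (r + r).+1).+1 <= n.
  by move: lt_n; rewrite gtn_max => /andP[-> /ltnW].
have n_gt0 : 0 < n by apply: leq_ltn_trans lt_nstar.
have M_gt0 : 0 < M by [].
have [subPH [closeH _]] := PH n lt_nstar.
exists (sampling_test R r M H n_gt0); split; [|split].
- move=> w G FG; apply: leq_trans (@sampling_queries R d r M n H n_gt0 w G FG) _.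
  exact: leq_addl.
- by move=> G /subPH[_ freeG]; apply: sampling_accept.
move=> G FG far; apply: (@sampling_reject R d r M n H) => // freeI.
apply: far; set B := rare d r M G in freeI.
have [G' PG' closeG'] := closeH _ (conj (isolate_FB B FG) freeI).
exists G' => //.
have card_B : (#|B|%:R * M%:R <= #|T|%:R * n%:R :> R)%R.
  by rewrite -!natrM ler_nat card_rare.
have T_gt0 : (0 < #|T|%:R :> R)%R.
  by rewrite ltr0n card_ffun expn_gt0 card_prod card_bool.
have M_large : (4 * #|T|%:R <= M%:R * eps :> R)%R.
  rewrite -ler_pdivrMr // ltW // (lt_trans (archi_boundP _)) ?ltr_nat //.
  by rewrite divr_ge0 ?mulr_ge0 // ltW.
(* Isolation changes at most [2 * d * #|B|] arcs, hence the factor 4 in [M]. *)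
have B_small : (4 * #|B|%:R <= eps * n%:R :> R)%R.
  rewrite -(ler_pM2r T_gt0).
  have := ler_wpM2r (ler0n R #|B|) M_large; have := ler_wpM2l (ltW eps_gt0) card_B.
  lra.
have edit : (edit_dist G G' <= #|B| * d.*2 + edit_dist (isolate G B) G')%N.
  apply: leq_trans (edit_dist_trans _ (isolate G B) _) _.
  by rewrite leq_add2r isolate_edit_dist.
move: edit closeG'; rewrite /eps_close -(ler_nat R) natrD natrM -muln2 natrM.
have d_ge0 := ler0n R d.
nra.
Qed.

Local Open Scope ring_scope.
Local Open Scope classical_set_scope.

Theorem theorem6p4 (R : realType) (d : nat) (P : digraph_class)
    (isoP : iso_closed P) (heredP : hereditary P) :
  one_sided_strongly_testable R d P <->
  (forall eps : R, 0 < eps ->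
     exists (r nstar : nat) (H : digraph_class),
       r_set r H /\
       forall n : nat, (nstar < n)%N ->
         (members d P n `<=` free_members d H n) /\
         close_sets d (eps / 2) (free_members d H n) (members d P n)).
Proof.
by split; [apply: testable_obstructions | apply: obstructions_testable].
Qed.
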